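(* Say that a word over an alphabet $\{0,1,\ldots,r\}$, $r\ge 1$, satisfies $\mathcal R$ if the letters $0$ and $1$ appear in it only as subwords of the form $1i$, where $i$ is a run of zeros of length at least $1$. Let $f_0(n)$ be the number of binary words (over $\{0,1\}$) of length $n-1$ satisfying $\mathcal R$, and let $f_m$, $c_m$ be the functions associated with $f_0$ as in the context. Then: (1) For $m\ge 1$ and $1\le k\le n$, the number $c_m(n,k)$ is the number of words over the alphabet $\{0,1,\ldots,m+1\}$ of length $n-1$ having exactly $k-1$ letters equal to $m+1$ and satisfying $\mathcal R$. (2) For $m\ge 0$ and $n\ge 1$, the number $f_m(n)$ is the number of words of length $n-1$ over the alphabet $\{0,1,\ldots,m+1\}$ satisfying $\mathcal R$.
   Context: For an arithmetic function $f_0$ defined on the positive integers, define recursively for $m\ge 1$ and $1\le k\le n$: $c_m(n,k)=\sum_{i_1+\cdots+i_k=n} f_{m-1}(i_1)\cdots f_{m-1}(i_k)$, the sum over positive integers $i_1,\ldots,i_k$, and $f_m(n)=\sum_{k=1}^n c_m(n,k)$. Condition $\mathcal R$ means that the word is a (possibly empty) concatenation of letters from $\{2,\ldots,r\}$ and blocks $10^j$ with $j\ge 1$. *)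

(* Defs.v *)
From mathcomp Require Import all_boot.
From mathcomp Require Import boolp.

Set Implicit Arguments.
Unset Strict Implicit.
Unset Printing Implicit Defensive.

(* Arithmetic functions are maps nat -> nat whose value at 0
   is irrelevant: every sum below only evaluates them at positive integers. *)

(* This is the sum over k-tuples (i_1, ..., i_k) of positive integers with
   i_1 + ... + i_k = n; such parts are at most n, hence the index type. *)
Definition composition_sum (f : nat -> nat) (n k : nat) : nat :=
  \sum_(i : {ffun 'I_k -> 'I_n.+1} |
         [forall j, 0 < i j] && (\sum_j i j == n))
     \prod_j f (i j).

Fixpoint f_seq (f0 : nat -> nat) (m n : nat) : nat :=
  if m is m'.+1 then \sum_(1 <= k < n.+1) composition_sum (f_seq f0 m') n k
  else f0 n.

(* Only meaningful for 1 <= m. *)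
Definition c_seq (f0 : nat -> nat) (m n k : nat) : nat :=
  composition_sum (f_seq f0 m.-1) n k.

Definition R_block (r : nat) (b : seq 'I_r.+1) : Prop :=
  (exists2 a : 'I_r.+1, 2 <= a & b = [:: a]) \/
  (exists2 j : nat, 1 <= j & map val b = 1 :: nseq j 0).

Definition satisfies_R (r : nat) (w : seq 'I_r.+1) : Prop :=
  exists2 bs : seq (seq 'I_r.+1),
    (forall b, b \in bs -> R_block b) & w = flatten bs.

(* The alphabet {0, ..., r} is 'I_r.+1. *)
Definition R_words (r l : nat) : {set l.-tuple 'I_r.+1} :=
  [set w : l.-tuple 'I_r.+1 | `[< satisfies_R w >]].

Definition f0_R (n : nat) : nat := #|R_words 1 n.-1|.

(* Main.v *)
Require Import Defs.
From mathcomp Require Import all_boot.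
From mathcomp Require Import ssralg poly boolp.

Set Implicit Arguments.
Unset Strict Implicit.
Unset Printing Implicit Defensive.

(** In a word over {0, ..., r+1} with r >= 1, the letter r+1 is at least 2, so
    it is a block of its own and separates the word into independent pieces:
    the word satisfies R iff each maximal subword avoiding r+1 does
    ([R_from_cat]).  A word of length n - 1 with k - 1 letters r+1 is therefore
    a sequence of k words over {0, ..., r}, each satisfying R, of lengths
    i_1 - 1, ..., i_k - 1 with i_1 + ... + i_k = n.  If f i counts the words of
    length i - 1 over {0, ..., r} satisfying R, this number is the composition
    sum of f at (n, k) ([composition_sum_R_words]).  Part (1) is this fact for
    f = f_{m-1}; summing over k gives all words, hence part (2) by induction
    on m.

    The correspondence is carried out by removing one piece at a time.  On the
    arithmetic side, composition sums are coefficients of the powers of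
    f 1 * X + f 2 * X^2 + ..., and splitting off one factor gives the
    recursion [composition_sumS].  On the side of words, splitting at the
    first occurrence of the largest letter gives the same recursion
    ([word_sum_first]).  To evaluate R on a concatenation, it is recognized by
    an automaton that remembers only the previous letter ([satisfies_RP]). *)

(** * Composition sums as coefficients of powers *)

(** The power series with coefficients f i for i >= 1 is truncated at degree N;
    its constant coefficient is 0 because parts of compositions are positive,
    whatever the value of f at 0. *)
Definition part_poly (f : nat -> nat) (N : nat) : {poly nat} :=
  (\poly_(i < N.+1) (if i == 0 then 0 else f i))%R.

(** Expanding the power by distributivity yields one monomial for every choice
    of exponents i : 'I_k -> 'I_n.+1; those with some exponent 0 vanish, and
    the coefficient extraction selects the sum n. *)
Lemma composition_sum_coef f n k :
  composition_sum f n k = ((part_poly f n ^+ k)`_n)%R.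
Proof.
have -> : (part_poly f n ^+ k = \sum_(i : {ffun 'I_k -> 'I_n.+1})
    (\prod_j (if i j == 0 :> nat then 0%N else f (i j)))%:P
      * 'X^(\sum_j i j)%N)%R.
  rewrite -[k in LHS]card_ord -GRing.prodr_const /part_poly poly_def.
  rewrite bigA_distr_bigA; apply: eq_bigr => i _.
  under eq_bigr => j _ do rewrite -mul_polyC.
  by rewrite big_split /= GRing.prodrXr GRing.rmorph_prod.
rewrite coef_sum /composition_sum big_mkcond /=; apply: eq_bigr => i _.
rewrite coefCM coefXn eq_sym.
case: (boolP [forall j, 0 < i j]) => [/forallP i_gt0|] /=.
  have -> : (\prod_j (if i j == 0 :> nat then 0%N else f (i j)) =
             \prod_j f (i j))%R.
    by apply: eq_bigr => j _; case: ifP (i_gt0 j) => [/eqP ->|].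
  by case: eqP => _; rewrite /= ?GRing.mulr1 ?GRing.mulr0.
rewrite negb_forall => /existsP [j]; rewrite -eqn0Ngt => /eqP ij0.
by rewrite (bigD1 j) //= ij0 /= !GRing.mul0r.
Qed.

(** The recursion on k evaluates composition sums at values smaller than n, each
    defined with its own bound on the parts; this lets all of them be
    computed in a single power. *)
Lemma part_poly_coef_stable f n N k : n <= N ->
  ((part_poly f N ^+ k)`_n = (part_poly f n ^+ k)`_n)%R.
Proof.
move=> le_nN.
suff coefs p : p <= n -> ((part_poly f N ^+ k)`_p = (part_poly f n ^+ k)`_p)%R.
  exact: coefs.
elim: k p => [|k IHk] p le_pn; first by rewrite !GRing.expr0.
rewrite !GRing.exprS !coefM; apply: eq_bigr => -[i /= le_ip] _.
rewrite ltnS in le_ip; have le_in := leq_trans le_ip le_pn.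
by rewrite !coef_poly !ltnS le_in (leq_trans le_in le_nN) IHk
  ?(leq_trans (leq_subr _ _)).
Qed.

Lemma composition_sum0 f n : composition_sum f n 0 = (n == 0).
Proof. by rewrite composition_sum_coef GRing.expr0 coef1; case: (n == 0). Qed.

(** The first part of the composition is i.+1. *)
Lemma composition_sumS f n k :
  composition_sum f n k.+1 =
    \sum_(i < n) f i.+1 * composition_sum f (n - i.+1) k.
Proof.
rewrite composition_sum_coef GRing.exprS coefM big_ord_recl.
rewrite {1}coef_poly /= GRing.mul0r GRing.add0r; apply: eq_bigr => i _.
rewrite coef_poly ltnS ltn_ord /= composition_sum_coef.
by rewrite part_poly_coef_stable ?leq_subr.
Qed.

Lemma composition_sum_0S f k : composition_sum f 0 k.+1 = 0.
Proof. by rewrite composition_sumS big_ord0. Qed.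

Lemma composition_sum1 f n : 0 < n -> composition_sum f n 1 = f n.
Proof.
case: n => // n _; rewrite composition_sumS big_ord_recr /= subnn.
rewrite composition_sum0 muln1 big1 // => i _.
by rewrite composition_sum0 subSS subn_eq0 leqNgt ltn_ord muln0.
Qed.

(** * Sums over words *)

(** Words over {0, ..., r} are viewed as sequences of naturals so that words
    over nested alphabets live in one type.  Summing an arbitrary nat-valued F,
    rather than counting, lets sums over pairs of words be nested sums. *)
Definition word_sum (r l : nat) (F : seq nat -> nat) : nat :=
  \sum_(w : l.-tuple 'I_r.+1) F (map val w).

Lemma word_sum0 r F : word_sum r 0 F = F [::].
Proof.
rewrite /word_sum (bigD1 [tuple]) //= big1 ?addn0 // => w.
by rewrite [w]tuple0 => /eqP.
Qed.

Lemma word_sumS r l F :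
  word_sum r l.+1 F =
    \sum_(a < r.+1) word_sum r l (fun w => F (val a :: w)).
Proof.
rewrite /word_sum pair_big_dep /=.
rewrite (reindex
  (fun aw : 'I_r.+1 * l.-tuple 'I_r.+1 => cons_tuple aw.1 aw.2)) //.
exists (fun w => (thead w, behead_tuple w)) => [[a w] _|w _] /=.
  by congr pair; apply: val_inj.
by rewrite [RHS]tuple_eta; apply: val_inj.
Qed.

Lemma eq_word_sum r l F G :
  (forall w, size w = l -> all (fun a => a <= r) w -> F w = G w) ->
  word_sum r l F = word_sum r l G.
Proof.
move=> eqFG; apply: eq_bigr => w _; apply: eqFG.
  by rewrite size_map size_tuple.
by apply/allP => _ /mapP[a _ ->]; rewrite -ltnS ltn_ord.
Qed.

Lemma word_sum_sum r l (I : finType) (F : I -> seq nat -> nat) :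
  word_sum r l (fun w => \sum_i F i w) = \sum_i word_sum r l (F i).
Proof. by rewrite /word_sum exchange_big. Qed.

Lemma word_sum_mulr r l F c :
  word_sum r l (fun w => F w * c) = word_sum r l F * c.
Proof. by rewrite /word_sum big_distrl. Qed.

Lemma word_sum_mull r l F c :
  word_sum r l (fun w => c * F w) = c * word_sum r l F.
Proof. by rewrite /word_sum big_distrr. Qed.

(** Either r.+1 does not occur in the word, or the word is u ++ r.+1 :: v for a
    unique u in which it does not occur, namely the prefix before its first
    occurrence.  By induction on the length: the first letter is either r.+1,
    which gives the term j = 0, or a smaller letter, which is moved into F. *)
Lemma word_sum_first r l F :
  word_sum r.+1 l F = word_sum r l F +
    \sum_(j < l) word_sum r j (fun u =>
      word_sum r.+1 (l - j.+1) (fun v => F (u ++ r.+1 :: v))).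
Proof.
elim: l F => [|l IHl] F; first by rewrite !word_sum0 big_ord0 addn0.
rewrite !word_sumS big_ord_recr [X in _ = _ + X]big_ord_recl /= word_sum0.
rewrite subSS subn0 addnA [in RHS]addnAC; congr (_ + _).
under eq_bigr => a _ do rewrite IHl.
rewrite big_split /=; congr (_ + _).
rewrite exchange_big; apply: eq_bigr => j _.
by rewrite /bump /= add1n word_sumS subSS.
Qed.

(** A word of length l has between 0 and l letters equal to s. *)
Lemma word_sum_by_count r l s (P : pred (seq nat)) :
  \sum_(k < l.+1) word_sum r l (fun w => P w && (count_mem s w == k)) =
    word_sum r l P.
Proof.
rewrite -word_sum_sum; apply: eq_word_sum => w size_w _.
have lt_c : count_mem s w < l.+1 by rewrite ltnS -size_w count_size.
rewrite (bigD1 (Ordinal lt_c)) //= eqxx andbT big1 ?addn0 // => k.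
by rewrite -val_eqE eq_sym => /negPf /= ->; rewrite andbF.
Qed.

(** * An automaton for the condition R *)

(** A 0 must continue a run started by a 1, and a 1 must be followed by a 0. *)
Definition R_step (p a : nat) : bool := if a == 0 then p <= 1 else p != 1.

(** Here p is the letter preceding w.  After a letter p >= 2, as at the start of
    a word, only 0 is forbidden, so p = 2 also serves as the initial state.
    The word may not end with a 1 still waiting for its 0. *)
Definition R_from (p : nat) (w : seq nat) : bool :=
  path R_step p w && (last p w != 1).

Lemma R_from_cons p a w : R_from p (a :: w) = R_step p a && R_from a w.
Proof. by rewrite /R_from /= andbA. Qed.

Lemma R_from_ge2 p w : 2 <= p -> R_from p w = R_from 2 w.
Proof. by case: p w => [|[|p]] // [|[|a] w]. Qed.

Lemma R_step_ge2 p a : 2 <= a -> R_step p a = (p != 1).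
Proof. by case: a => [|[]]. Qed.

(** A letter s >= 2 resets the automaton, so it separates independent pieces. *)
Lemma R_from_cat p u s v : 2 <= s ->
  R_from p (u ++ s :: v) = R_from p u && R_from 2 v.
Proof.
move=> s_ge2; rewrite -(R_from_ge2 v s_ge2) /R_from cat_path last_cat /= -!andbA.
by rewrite R_step_ge2.
Qed.

Lemma R_from0 w : R_from 2 w -> R_from 0 w.
Proof. by case: w => [|[|a] w]. Qed.

Lemma R_from_block r (b : seq 'I_r.+1) w :
  R_block b -> R_from 2 w -> R_from 2 (map val b ++ w).
Proof.
case=> [[a a_ge2 ->]|[j j_gt0 ->]] Rw /=.
  by rewrite R_from_cons R_step_ge2 // R_from_ge2.
case: j j_gt0 => // j _ /=; rewrite !R_from_cons /=.
elim: j => [|j IHj] /=; first exact: R_from0.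
by rewrite R_from_cons.
Qed.

Lemma satisfies_R_cat r (b w : seq 'I_r.+1) :
  R_block b -> satisfies_R w -> satisfies_R (b ++ w).
Proof.
move=> Rb [bs Rbs ->]; exists (b :: bs) => // c.
by rewrite inE => /predU1P[->|/Rbs].
Qed.

(** Stated for every previous letter p so that induction on w applies: when p is
    0 or 1, the leading zeros of w belong to the block that p is part of. *)
Lemma R_from_decomp r p (w : seq 'I_r.+1) : R_from p (map val w) ->
  exists j (v : seq 'I_r.+1), [/\ w = nseq j ord0 ++ v, satisfies_R v,
    2 <= p -> j = 0 & p = 1 -> 0 < j].
Proof.
elim: w p => [|a w IHw] p.
  rewrite /R_from /= => /eqP p_neq1.
  by exists 0, [::]; split=> //; exists [::].
rewrite [map _ _]/= R_from_cons => /andP[pa /IHw [j [v [def_w Rv j0 j_gt0]]]].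
have [a0 | a_neq0] := eqVneq (val a) 0.
  exists j.+1, v; split=> //.
    by rewrite def_w; congr cons; apply: val_inj.
  by move: pa; rewrite /R_step a0 /= => /leq_gtF ->.
have p_neq1 : p <> 1 by move: pa; rewrite /R_step (negPf a_neq0) => /eqP.
exists 0, (a :: w); split=> //; have [a1 | a_neq1] := eqVneq (val a) 1.
  rewrite def_w -cat_cons; apply: satisfies_R_cat => //; right.
  by exists j; [exact: j_gt0 | rewrite /= a1 map_nseq].
have a_ge2 : 2 <= a by move: a_neq0 a_neq1 => /=; case: (nat_of_ord a) => [|[]].
rewrite -cat1s; apply: satisfies_R_cat; first by left; exists a.
by rewrite def_w (j0 a_ge2).
Qed.

Lemma satisfies_RP r (w : seq 'I_r.+1) :
  `[< satisfies_R w >] = R_from 2 (map val w).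
Proof.
apply/asboolP/idP => [[bs Rbs ->]|/R_from_decomp[j [v [-> Rv j0 _]]]]; last first.
  by rewrite j0.
elim: bs Rbs => //= b bs IHbs Rbs.
rewrite map_cat; apply: R_from_block; first by apply: Rbs; rewrite mem_head.
by apply: IHbs => c c_bs; apply: Rbs; rewrite inE c_bs orbT.
Qed.

Lemma card_R_words r l : #|R_words r l| = word_sum r l (R_from 2).
Proof.
rewrite -sum1_card big_mkcond; apply: eq_bigr => w _.
by rewrite inE satisfies_RP; case: R_from.
Qed.

Lemma card_R_words_count r l s k :
  #|[set w in R_words r l | count (fun a : 'I_r.+1 => val a == s) w == k]| =
    word_sum r l (fun w => R_from 2 w && (count_mem s w == k)).
Proof.
rewrite -sum1_card big_mkcond; apply: eq_bigr => w _.
by rewrite !inE satisfies_RP count_map; case: (_ && _).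
Qed.

Lemma count_mem_max r w : all (fun a => a <= r) w -> count_mem r.+1 w = 0.
Proof.
move=> /allP w_le; apply/count_memPn/negP => /w_le.
by rewrite ltnn.
Qed.

(** * Words with a given number of largest letters *)

(** Both sides satisfy the same recursion on k, where the first part j.+1 of the
    composition corresponds to a word u of length j before the first separator
    r.+1.  The hypothesis 0 < r makes r.+1 at least 2, as [R_from_cat]
    requires. *)
Lemma composition_sum_R_words r f : 0 < r ->
  (forall i, 0 < i -> f i = #|R_words r i.-1|) ->
  forall n k, 0 < n ->
    composition_sum f n k.+1 =
      word_sum r.+1 n.-1 (fun w => R_from 2 w && (count_mem r.+1 w == k)).
Proof.
move=> r_gt0 f_words n k; elim: k n => [|k IHk] [//|l] _.
  (* With no separator allowed, only words over the smaller alphabet count. *)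
  rewrite composition_sum1 // f_words // card_R_words word_sum_first /=.
  rewrite [X in _ + X]big1 ?addn0 => [|j _].
    by apply: eq_word_sum => w _ /count_mem_max ->; rewrite andbT.
  rewrite /word_sum big1 // => u _; rewrite big1 // => v _.
  by rewrite count_cat /= eqxx addnCA addnA andbF.
(* The part equal to n leaves nothing for the k.+1 others, while a word with
   k.+1 separators cannot avoid r.+1: both boundary terms vanish. *)
rewrite composition_sumS big_ord_recr /= subnn composition_sum_0S muln0 addn0.
rewrite word_sum_first [X in X + _](_ : _ = 0) ?add0n; last first.
  rewrite -[RHS](muln0 (word_sum r l (fun=> 0))) -word_sum_mulr.
  by apply: eq_word_sum => w _ /count_mem_max ->; rewrite andbF.
apply: eq_bigr => j _; rewrite subSS IHk ?subn_gt0 // f_words // card_R_words.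
rewrite -word_sum_mulr subnS; apply: eq_word_sum => u _ /count_mem_max u_s.
rewrite -word_sum_mull; apply: eq_word_sum => v _ _.
by rewrite R_from_cat // count_cat u_s /= eqxx eqSS mulnb andbA.
Qed.

Lemma f_seq_R_words m n : 0 < n -> f_seq f0_R m n = #|R_words m.+1 n.-1|.
Proof.
elim: m n => [|m IHm] // [//|l] _ /=.
rewrite card_R_words -(word_sum_by_count _ _ m.+2) big_add1 big_mkord /=.
by apply: eq_bigr => k _; rewrite (composition_sum_R_words _ IHm).
Qed.

Theorem corollary8 :
  (forall m n k : nat, 1 <= m -> 1 <= k -> k <= n ->
     c_seq f0_R m n k =
       #|[set w in R_words m.+1 n.-1 |
            count (fun a : 'I_m.+2 => val a == m.+1) w == k.-1]|)
  /\
  (forall m n : nat, 1 <= n ->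
     f_seq f0_R m n = #|R_words m.+1 n.-1|).
Proof.
split=> [[//|m] n [//|k] _ _ lt_kn|m n]; last exact: f_seq_R_words.
rewrite card_R_words_count /c_seq.
by rewrite (composition_sum_R_words _ (@f_seq_R_words m)) // (leq_trans _ lt_kn).
Qed.
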